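(* For every integer $d\geq 5$ and every real $0 \leq r<1$, there is a simplicial $d$-polytope $P$ with $\rho(H(P)) \geq r$.
   Context: For a hypergraph $H=(V,\mathcal{E})$, a transversal is a subset of $V$ intersecting every hyperedge in $\mathcal{E}$; the transversal number $\tau(H)$ is the minimum size of a transversal, and the transversal ratio is $\rho(H)=\tau(H)/|V|$. For a $d$-polytope $P$ with vertex set $V$, $H(P)$ is the hypergraph on $V$ whose hyperedges are the vertex sets of the facets of $P$. *)

(* Defs.v *)
From HB Require Import structures.
From mathcomp Require Import all_boot all_order all_algebra.
From mathcomp Require Import Rstruct.
From Stdlib Require Rdefinitions.
From mathcomp Require Import boolp.
Notation R := Rdefinitions.R.
Set Implicit Arguments. Unset Strict Implicit. Unset Printing Implicit Defensive.
Import Order.TTheory GRing.Theory Num.Theory.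
Local Open Scope ring_scope.

Section Polytope.
Variables (d n : nat) (p : 'I_n -> 'rV[R]_d).

Definition in_conv (S : {set 'I_n}) (x : 'rV[R]_d) : Prop :=
  exists w : 'I_n -> R,
    [/\ forall i, 0 <= w i,
        forall i, i \notin S -> w i = 0,
        \sum_(i < n) w i = 1
      & x = \sum_(i < n) w i *: p i].

(* The points are in convex position: no p i is in the convex hull of the
   others.  Then the vertex set of the polytope conv{p i} is exactly {p i}. *)
Definition convex_position : Prop :=
  forall i : 'I_n, ~ in_conv [set~ i] (p i).

(* Homogenized points (p i, 1) for i in S, stacked as rows (zero rows
   outside S).  Its rank is 1 + dim aff{p i | i in S} (for S nonempty). *)
Definition hom_mx (S : {set 'I_n}) : 'M[R]_(n, d + 1) :=
  \matrix_(i < n) (if i \in S then row_mx (p i) (1 : 'rV[R]_1) else 0).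

Definition aff_rank (S : {set 'I_n}) : nat := \rank (hom_mx S).

Definition aff_indep (S : {set 'I_n}) : bool := aff_rank S == #|S|.

Definition full_dim : Prop := aff_rank setT = d.+1.

Definition dot (a x : 'rV[R]_d) : R := \sum_(j < d) a 0 j * x 0 j.

Definition is_facet (F : {set 'I_n}) : Prop :=
  exists (a : 'rV[R]_d) (b : R),
    [/\ a != 0,
        forall i, dot a (p i) <= b,
        F = [set i | dot a (p i) == b]
      & aff_rank F = d].

Definition simplicial : Prop :=
  forall F, is_facet F -> aff_indep F.

(* Hypergraph H(P): vertex set 'I_n, hyperedges = facet vertex sets. *)
Definition transversal (T : {set 'I_n}) : Prop :=
  forall F, is_facet F -> exists2 i, i \in T & i \in F.

(* transversal number: minimum size of a transversal (V itself is always one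
   as soon as there is a facet; default n otherwise). *)
Definition tau : nat :=
  \big[minn/n]_(T : {set 'I_n} | `[< transversal T >]) #|T|.

Definition rho : R := (tau%:R / n%:R).

End Polytope.

(* Main.v *)
(* Idea. Fix d orders on a finite set and place point i at (u^(x_1 i), ..., u^(x_d i)),
   where x_j is the rank in the j-th order and u is huge. If p_1, ..., p_d are such that
   p_j is the largest of them in order j and every other point exceeds p_j in order j for
   some j, then {p_1, ..., p_d} is a facet: suitable a_j near u^(- x_j p_j) give a functional
   sum_j a_j z_j equal to 1 at the p_i and larger than 1 elsewhere. Adding the point
   (i, i^2, ..., i^d) of the moment curve makes the configuration generic, hence simplicial.

   It remains to find orders for which every subset S of positive density contains such a
   d-tuple. Put the points on a line and give each one a word of m letters, chosen level by
   level. Two orders come from the line (both directions), two from the lexicographic order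
   of the words (both directions), and each remaining one only detects a single letter. A
   class of points with a common prefix splits into blocks of bounded length L; on a block
   containing d points of S, the next letters produce a good d-tuple with probability at
   least q^-L, so S survives a level with probability exponentially small in n. As there are
   at most 2^n sets S, a bounded number of levels leaves none of them. *)

Require Import Defs.
From mathcomp Require Import all_boot all_order all_algebra.
From mathcomp Require Import Rstruct.
From Stdlib Require Rdefinitions.
From mathcomp Require Import boolp.
From mathcomp Require Import zify ring lra.
Set Implicit Arguments. Unset Strict Implicit. Unset Printing Implicit Defensive.
Import Order.TTheory GRing.Theory Num.Theory.
Local Open Scope ring_scope.

(** * Counting: letters for which every dense set contains a good tuple *)

Section Combinatorics.
Local Open Scope nat_scope.

(* Over all F : J -> C, the fraction avoiding h S on all of G S is (1 - 1/#|C|) ^ #|G S|. *)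
Lemma averaging (X J C : finType) (SS : {set X}) (G : X -> {set J})
    (h : X -> J -> C) (g : nat) :
  0 < #|C| -> (forall S, S \in SS -> g <= #|G S|) ->
  exists F : {ffun J -> C},
    #|[set S in SS | [forall j in G S, F j != h S j]]| * #|C| ^ g
      <= #|SS| * #|C|.-1 ^ g.
Proof.
move=> C0 hG.
pose bad F := [set S in SS | [forall j in G S, F j != h S j]].
apply: contrapT => nF.
have ltF (F : {ffun J -> C}) : #|SS| * #|C|.-1 ^ g < #|bad F| * #|C| ^ g.
  by rewrite ltnNge; apply/negP => hF; apply: nF; exists F.
have sum_bad : \sum_(F : {ffun J -> C}) #|bad F| * #|C| ^ g
             <= #|{ffun J -> C}| * (#|SS| * #|C|.-1 ^ g).
  rewrite -big_distrl /=.
  under eq_bigr => F _ do rewrite -sum1_card.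
  rewrite (exchange_big_dep [in SS]) /=; last by move=> F S _; rewrite inE => /andP[].
  rewrite mulnCA -sum_nat_const !big_distrl /=; apply: leq_sum => S SSS.
  rewrite sum1_card.
  (* For fixed [S] the bad [F] form a product: one value is forbidden at each index of [G S], none
     elsewhere. *)
  have -> : #|[pred F : {ffun J -> C} | S \in bad F]| =
     #|(family (fun j => [pred c | (j \in G S) ==> (c != h S j)]) : pred {ffun J -> C})|.
    apply: eq_card => F; apply/idP/familyP => [|H].
      by rewrite !inE SSS /= => /forallP H j; have := H j; rewrite inE.
    by rewrite !inE SSS /=; apply/forallP => j; have := H j; rewrite inE.
  rewrite card_family foldrE big_map big_enum /=.
  rewrite (bigID (mem (G S))) /=.
  rewrite (eq_bigr (fun=> #|C|.-1)); last first.
    move=> j jG; rewrite -(cardC1 (h S j)); apply: eq_card => c.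
    by rewrite !inE jG.
  rewrite [X in _ * X * _](eq_bigr (fun=> #|C|)); last first.
    move=> j jG; apply: eq_card => c.
    by rewrite !inE (negbTE jG).
  rewrite !prod_nat_const card_ffun.
  have -> : #|[pred j | j \notin G S]| = #|~: G S| by apply: eq_card => j; rewrite !inE.
  rewrite -(cardsC (G S)).
  rewrite -(subnKC (hG _ SSS)) !expnD.
  move: (#|G S| - g) => a.
  have : #|C|.-1 ^ a <= #|C| ^ a by case: a => // a; rewrite leq_exp2r ?leq_pred.
  move: (#|C| ^ g) (#|C|.-1 ^ g) (#|C| ^ a) (#|C|.-1 ^ a) (#|C| ^ #|~: G S|) => x y z t w tz.
  have -> : y * t * w * x = x * w * y * t by ring.
  have -> : x * z * w * y = x * w * y * z by ring.
  by rewrite leq_mul.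
have : \sum_(F : {ffun J -> C}) #|SS| * #|C|.-1 ^ g
     < \sum_(F : {ffun J -> C}) #|bad F| * #|C| ^ g.
  have [c _] : exists c : C, c \in C by apply/card_gt0P.
  rewrite (bigD1 [ffun=> c]) //= [X in _ < X](bigD1 [ffun=> c]) //=.
  by rewrite -addSn leq_add // leq_sum // => F _; rewrite ltnW.
rewrite sum_nat_const.
by rewrite ltnNge sum_bad.
Qed.

(** * Cutting label classes into blocks of bounded length *)

Section Blocks.
Variables (n K : nat) (L : nat) (lab : 'I_n -> nat).
Hypothesis labK : forall i, lab i < K.
Hypothesis L0 : 0 < L.

Definition fiber_rank (i : 'I_n) := #|[set i' : 'I_n | (i' < i) && (lab i' == lab i)]|.

Lemma fiber_rank_lt (i i' : 'I_n) : lab i = lab i' -> i < i' -> fiber_rank i < fiber_rank i'.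
Proof.
move=> e lt_ii'; apply: proper_card; apply/properP; split.
  apply/subsetP => a; rewrite !inE e => /andP[ai ->].
  by rewrite (ltn_trans ai).
by exists i; rewrite !inE ?ltnn // lt_ii' e eqxx.
Qed.

Lemma fiber_rank_le (i i' : 'I_n) : lab i = lab i' -> i <= i' -> fiber_rank i <= fiber_rank i'.
Proof.
by rewrite leq_eqVlt => e /orP[/eqP/val_inj-> //|h]; rewrite ltnW // fiber_rank_lt.
Qed.

Lemma fiber_rank_inj (i i' : 'I_n) : lab i = lab i' -> fiber_rank i = fiber_rank i' -> i = i'.
Proof.
move=> e er; apply: val_inj; case: (ltngtP i i') => // h.
  by have := fiber_rank_lt e h; rewrite er ltnn.
by have := fiber_rank_lt (esym e) h; rewrite er ltnn.
Qed.

Lemma fiber_rank_card (i : 'I_n) : fiber_rank i < #|[set i' | lab i' == lab i]|.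
Proof.
apply: proper_card; apply/properP; split; last by exists i; rewrite !inE ?ltnn.
by apply/subsetP => a; rewrite !inE => /andP[].
Qed.

Lemma block_index_subproof (i : 'I_n) : fiber_rank i %/ L < n.
Proof.
apply: leq_ltn_trans (leq_div _ _) (leq_trans (fiber_rank_card i) _).
by rewrite -[leqRHS]card_ord max_card.
Qed.

(** Along the line, each label class is cut into runs of [L] consecutive members; a block is named
    by its label and the number of the run. *)
Definition block (i : 'I_n) : 'I_K * 'I_n :=
  (Ordinal (labK i), Ordinal (block_index_subproof i)).

Definition position (i : 'I_n) : 'I_L := Ordinal (ltn_pmod (fiber_rank i) L0).

Lemma block_lab (i i' : 'I_n) : block i = block i' -> lab i = lab i'.
Proof. by case. Qed.

Lemma position_inj (i i' : 'I_n) : block i = block i' -> position i = position i' -> i = i'.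
Proof.
move=> [e q] [r]; apply: (fiber_rank_inj e).
by rewrite (divn_eq (fiber_rank i) L) q r -divn_eq.
Qed.

Lemma block_convex (i j k : 'I_n) : block i = block k -> lab j = lab i ->
  i <= j <= k -> block j = block i.
Proof.
move=> eb el /andP[ij jk]; have elk := block_lab eb.
case: eb => _ eb.
congr pair; apply: val_inj => //=; apply/eqP; rewrite eqn_leq.
have h1 : fiber_rank i <= fiber_rank j by apply: fiber_rank_le.
have h2 : fiber_rank j <= fiber_rank k by apply: fiber_rank_le; rewrite // el.
by rewrite [X in _ && X]leq_div2r // eb leq_div2r.
Qed.

Lemma card_block (j : 'I_K * 'I_n) : #|[set i | block i == j]| <= L.
Proof.
rewrite -[leqRHS]card_ord -(card_in_imset (f := position)) ?max_card //.
by move=> a b; rewrite !inE => /eqP ea /eqP eb; apply: position_inj; rewrite ea.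
Qed.

Lemma sum_ltn_bound (m a : nat) : \sum_(b < m) (b < a : nat) <= a.
Proof.
suff -> : \sum_(b < m) (b < a : nat) = minn m a by rewrite geq_minr.
elim: m => [|m IH]; first by rewrite big_ord0 min0n.
rewrite big_ord_recr /= IH; case: ltnP => h /=; lia.
Qed.

(** A class of [a] points meets at most [a %/ L + 1] blocks; the sum is over the [K] classes. *)
Lemma card_nonempty_blocks : L * #|[set j | [exists i, block i == j]]| <= n + L * K.
Proof.
pose fib w := #|[set i | lab i == w]|.
have le1 : #|[set j | [exists i, block i == j]]| <= \sum_(w < K) (fib w %/ L).+1.
  rewrite -sum1_card big_mkcond /=.
  rewrite (eq_bigr (fun j => [exists i, block i == (j.1, j.2)] : nat)); last first.
    by move=> -[w b] _; rewrite inE; case: ifP.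
  rewrite -(pair_bigA _ (fun w b => [exists i, block i == (w, b)] : nat)) /=.
  apply: leq_sum => w _; apply: leq_trans (sum_ltn_bound n _); apply: leq_sum => b _.
  case: existsP => // -[i /eqP[<- <-]] /=.
  by rewrite ltnS leq_div2r // ltnW // fiber_rank_card.
apply: leq_trans (leq_mul (leqnn L) le1) _.
rewrite big_distrr /=.
have <- : \sum_(w < K) fib w = n.
  rewrite -[RHS]card_ord -sum1_card (partition_big (fun i => Ordinal (labK i)) xpredT) //=.
  apply: eq_bigr => w _; rewrite /fib -sum1_card; apply: eq_bigl => i.
  by rewrite inE.
have -> : L * K = \sum_(w < K) L by rewrite sum_nat_const card_ord mulnC.
rewrite -big_split /=.
by apply: leq_sum => w _; rewrite mulnS addnC leq_add2r mulnC leq_trunc_div.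
Qed.

Definition rich_blocks (k : nat) (S : {set 'I_n}) : {set 'I_K * 'I_n} :=
  [set j | k <= #|[set i in S | block i == j]|].

(** A rich block holds at most [L] points of [S], any other nonempty block fewer than [k]. *)
Lemma card_rich_blocks (k : nat) (S : {set 'I_n}) :
  L * #|S| <= L * (L * #|rich_blocks k S|) + k * (n + L * K).
Proof.
set G := rich_blocks k S; set N := [set j | [exists i, block i == j]].
suff le1 : #|S| <= L * #|G| + k * #|N|.
  apply: leq_trans (leq_mul (leqnn L) le1) _; rewrite mulnDr leq_add2l mulnCA.
  by rewrite leq_mul2l card_nonempty_blocks orbT.
rewrite -sum1_card (partition_big block (mem N)) /=; last first.
  by move=> i _; rewrite inE; apply/existsP; exists i.
rewrite (bigID (mem G)) /= leq_add //.
  apply: (@leq_trans (\sum_(j in G) L)); last by rewrite sum_nat_const mulnC.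
  rewrite big_mkcondl /= [leqRHS]big_mkcond [leqLHS]big_mkcond /=.
  apply: leq_sum => j _; case: (j \in G) => //; case: ifP => // _.
  rewrite sum1_card; apply: leq_trans (card_block j); apply: subset_leq_card.
  by apply/subsetP => i; rewrite !inE => /andP[].
apply: (@leq_trans (\sum_(j in N) k)); last by rewrite sum_nat_const mulnC.
rewrite big_mkcondr /=; apply: leq_sum => j _; case: ifP => // jG.
move: jG; rewrite inE -ltnNge => /ltnW.
by rewrite -sum1_card; congr (_ <= _); apply: eq_bigl => i; rewrite !inE.
Qed.

End Blocks.

(** * Choosing letters level by level *)

Section Hit.
Variables (n q k : nat) (pat : 'I_k -> 'I_q) (hi : 'I_q).

(* [lab] encodes the letters chosen so far and [f] is the next letter. The letter [hi]
   marks the points of the class lying between the [p t] that are not among them. *)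
Definition hit (lab : 'I_n -> nat) (f : 'I_n -> 'I_q) (S : {set 'I_n}) : Prop :=
  exists p : 'I_k -> 'I_n,
    [/\ forall t, p t \in S,
        forall s t : 'I_k, s < t -> p s < p t,
        forall s t, lab (p s) = lab (p t),
        forall t, f (p t) = pat t
      & forall (i : 'I_n) s t, p s <= i <= p t -> lab i = lab (p s) ->
          (exists t', i = p t') \/ f i = hi].

Lemma enum_ordered (A : {set 'I_n}) (i0 : 'I_n) (s t : nat) :
  s < t < #|A| -> nth i0 (enum A) s < nth i0 (enum A) t.
Proof.
move=> /andP[st tA].
have srt : sorted (relpre val ltn) (enum A).
  rewrite {1}/enum_mem; apply: sorted_filter; first by move=> a b c; apply: ltn_trans.
  by rewrite -enumT -sorted_map val_enum_ord iota_ltn_sorted.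
apply: (sorted_ltn_nth _ i0 srt) => //.
- by move=> a b c; apply: ltn_trans.
- by rewrite inE -cardE (ltn_trans st).
- by rewrite inE -cardE.
Qed.

(** Averaging is applied with a whole filling of a block by letters as one value, hence [q ^ L]
    values. In each rich block one filling produces a hit. *)
Lemma level_step (K L E g : nat) (lab : 'I_n -> nat) (SS : {set {set 'I_n}}) :
  0 < E -> 0 < k -> L = 4 * E * k -> n = 2 * E * L * g -> 4 * E * k * K <= n ->
  (forall i, lab i < K) ->
  (forall S, S \in SS -> n <= E * #|S|) ->
  exists f : 'I_n -> 'I_q,
    #|[set S in SS | ~~ `[< hit lab f S >]]| * (q ^ L) ^ g <= #|SS| * (q ^ L).-1 ^ g.
Proof.
move=> E0 k0 eL en leK labK bigS.
have L0 : 0 < L by rewrite eL !muln_gt0 E0 k0.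
pose B := block L labK; pose P := position lab L0.
pose G := rich_blocks L labK k.
have Gg S : S \in SS -> g <= #|G S|.
  move=> SSS; have := card_rich_blocks labK L0 k S; rewrite -/G => h1.
  have h2 := bigS _ SSS.
  (* By the choice of [L] and the bound on [K], each of the two error terms is at most a quarter of
     [L * n]; the remaining half forces [g] rich blocks. *)
  have h3 : L * n <= L * (E * L * #|G S| + E * k * K) + E * k * n by nia.
  have h4 : 4 * (E * k * n) = L * n by rewrite eL; ring.
  have h5 : L * (4 * (E * k * K)) <= L * n by rewrite leq_mul2l; apply/orP; right; lia.
  have h6 : L * (2 * (E * L * g)) <= L * (2 * (E * L * #|G S|)).
    rewrite {3}en in h3 *. nia.
  move: h6; rewrite !leq_pmul2l ?muln_gt0 ?E0 //.
pose pts (S : {set 'I_n}) (j : 'I_K * 'I_n) (t : 'I_k) : 'I_n :=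
  nth j.2 (enum [set i in S | B i == j]) t.
(* The winning filling: [pat] on the first [k] points of [S] in the block, [hi] at all other
   positions. *)
pose h S (j : 'I_K * 'I_n) : {ffun 'I_L -> 'I_q} :=
  [ffun s => if [pick t | P (pts S j t) == s] is Some t then pat t else hi].
have C0 : 0 < #|{ffun 'I_L -> 'I_q}|.
  by apply/card_gt0P; exists [ffun=> hi].
have [F] := averaging h C0 Gg.
rewrite card_ffun !card_ord => hF.
exists (fun i => F (B i) (P i)).
apply: leq_trans _ hF; rewrite leq_mul2r; apply/orP; right.
apply: subset_leq_card; apply/subsetP => S; rewrite !inE => /andP[-> /asboolPn nhit] /=.
apply/forallP => j; apply/implyP => jG; apply/eqP => Fj; apply: nhit.
have cardj : k <= #|[set i in S | B i == j]| by move: jG; rewrite inE.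
have ptsP t : pts S j t \in [set i in S | B i == j].
  by rewrite -mem_enum mem_nth // -cardE (leq_trans _ cardj).
have ptsB t : B (pts S j t) = j by have := ptsP t; rewrite inE => /andP[_ /eqP].
have pts_lt (s t : 'I_k) : s < t -> pts S j s < pts S j t.
  by move=> st; apply: enum_ordered; rewrite st (leq_trans _ cardj).
have pts_inj : injective (pts S j).
  move=> s t e; apply: val_inj; case: (ltngtP s t) => // /pts_lt; by rewrite e ltnn.
exists (pts S j); split.
- by move=> t; have := ptsP t; rewrite inE => /andP[].
- exact: pts_lt.
- by move=> s t; apply: (@block_lab n K L lab labK); rewrite -/B !ptsB.
- move=> t; rewrite ptsB Fj ffunE; case: pickP => [t' /eqP e|/(_ t)]; last by rewrite eqxx.
  congr pat; apply: pts_inj; apply: (position_inj (labK := labK)) e.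
  by rewrite -/B !ptsB.
- move=> i s t ist el.
  have Bi : B i = j.
    rewrite -(ptsB s); apply: (block_convex _ (k := pts S j t)) => //.
    by rewrite -/B !ptsB.
  rewrite Bi Fj ffunE; case: pickP => [t' /eqP e|_]; last by right.
  left; exists t'; apply: (position_inj (labK := labK)) (esym e).
  by rewrite -/B ptsB Bi.
Qed.

(* The word of [i] lists the newest letter first: the head of [fs] is the last digit. *)
Fixpoint code (s : 'I_q -> nat) (fs : seq ('I_n -> 'I_q)) (i : 'I_n) : nat :=
  if fs is f :: fs' then code s fs' i * q + s (f i) else 0.

Lemma code_lt s fs i : (forall a, s a < q) -> code s fs i < q ^ size fs.
Proof.
move=> sq; elim: fs => [|f fs IH] /=; first by rewrite expn0.
by rewrite expnS; have := sq (f i); nia.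
Qed.

(** Newer letters are less significant digits, so they cannot overturn what older ones decide. *)
Lemma code_mono s fs fs' i j : (forall a, s a < q) ->
  code s fs i < code s fs j -> code s (fs' ++ fs) i < code s (fs' ++ fs) j.
Proof.
move=> sq; elim: fs' => [|f fs' IH] //= /IH.
by have := sq (f i); nia.
Qed.

(** Base-[q] digits are unique, so equal codes come from equal words, whatever value [s] gives to
    the letters. *)
Lemma code_inj s fs i j :
  code (@nat_of_ord _) fs i = code (@nat_of_ord _) fs j -> code s fs i = code s fs j.
Proof.
elim: fs => [|f fs IH] //= e.
have q0 : 0 < q := leq_ltn_trans (leq0n _) (ltn_ord (f i)).
have ef : f i = f j.
  by apply: val_inj; rewrite /= -(modn_small (ltn_ord (f i))) -(modn_small (ltn_ord (f j)))
    -(modnMDl (code (@nat_of_ord _) fs i)) e modnMDl.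
by move/eqP: e; rewrite ef eqn_add2r eqn_pmul2r // => /eqP/IH->.
Qed.

Fixpoint unhit (fs : seq ('I_n -> 'I_q)) (S : {set 'I_n}) : bool :=
  if fs is f :: fs' then unhit fs' S && ~~ `[< hit (code (@nat_of_ord _) fs') f S >] else true.

(** Each level is applied to the survivors of the previous ones; words of length below [m] give at
    most [q ^ m] classes. *)
Lemma levels (m L E g : nat) :
  0 < E -> 0 < k -> L = 4 * E * k -> n = 2 * E * L * g -> 4 * E * k * q ^ m <= n ->
  exists2 fs, size fs = m &
    #|[set S : {set 'I_n} | (n <= E * #|S|) && unhit fs S]| * (q ^ L) ^ (g * m)
      <= 2 ^ n * (q ^ L).-1 ^ (g * m).
Proof.
move=> E0 k0 eL en; elim: m => [|m IH] le_n.
  exists [::] => //; rewrite !muln0 !expn0 !muln1.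
  apply: leq_trans (max_card _) _.
  by rewrite -cardsT -powersetT card_powerset cardsT card_ord.
have q0 : 0 < q := leq_ltn_trans (leq0n _) (ltn_ord hi).
have [|fs sfs hfs] := IH.
  by apply: leq_trans le_n; rewrite leq_mul2l leq_pexp2l ?orbT.
have [||f hf] := @level_step (q ^ m) L E g (code (@nat_of_ord _) fs)
  [set S : {set 'I_n} | (n <= E * #|S|) && unhit fs S] E0 k0 eL en
  (leq_trans (leq_mul (leqnn _) (leq_pexp2l q0 (leqnSn m))) le_n).
- by move=> i; rewrite -sfs; apply: code_lt => a; apply: ltn_ord.
- by move=> S; rewrite inE => /andP[].
exists (f :: fs); first by rewrite /= sfs.
rewrite mulnS !expnD.
have -> : [set S : {set 'I_n} | (n <= E * #|S|) && unhit (f :: fs) S] =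
 [set S in [set S : {set 'I_n} | (n <= E * #|S|) && unhit fs S] | ~~ `[< hit (code (@nat_of_ord _) fs) f S >]].
  by apply/setP => S; rewrite !inE /= andbA.
rewrite mulnA; apply: leq_trans (leq_mul hf (leqnn _)) _.
rewrite -mulnA [X in _ * X <= _]mulnC mulnA.
by apply: leq_trans (leq_mul hfs (leqnn _)) _; rewrite -mulnA [X in _ * X <= _]mulnC.
Qed.

Lemma unhitPn fs S : ~~ unhit fs S ->
  exists fs1 f fs2, fs = fs1 ++ f :: fs2 /\ hit (code (@nat_of_ord _) fs2) f S.
Proof.
elim: fs => //= f fs IH; rewrite negb_and negbK => /orP[/IH[fs1 [g [fs2 [-> h]]]]|/asboolP h].
  by exists (f :: fs1), g, fs2.
by exists [::], f, fs.
Qed.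

End Hit.

Lemma large_power_ratio (Q D : nat) : 1 < Q -> exists2 m, 0 < m & 2 ^ D * Q.-1 ^ m < Q ^ m.
Proof.
(* With this [m], the second term of the Bernoulli-type bound [bern] is exactly
   [2 ^ D * c.+1 ^ m]. *)
case: Q => [|[|c]] // _; exists (c.+1 * 2 ^ D); rewrite ?muln_gt0 ?expn_gt0 //.
set m := (_ * 2 ^ D)%N => /=.
have bern j : c.+1 ^ j.+1 + j.+1 * c.+1 ^ j <= c.+2 ^ j.+1.
  elim: j => [|j IH]; first by rewrite !expn1 expn0; lia.
  rewrite (expnS c.+2) (expnS c.+1 j.+1); move: IH; rewrite (expnS c.+1 j).
  by move: (c.+2 ^ _) (c.+1 ^ _) => x y; nia.
have m0 : 0 < m by rewrite muln_gt0 expn_gt0.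
have := bern m.-1; rewrite prednK // => h; apply: leq_trans h.
have -> : m * c.+1 ^ m.-1 = 2 ^ D * c.+1 ^ m.
  by rewrite -{3}(prednK m0) expnS /m; ring.
by rewrite addnC -addn1 leq_add2l expn_gt0.
Qed.

Lemma dense_hitting (k q E n0 : nat) (pat : 'I_k -> 'I_q) (hi : 'I_q) :
  0 < E -> 0 < k -> 1 < q ->
  exists (n : nat) (fs : seq ('I_n -> 'I_q)), n0 <= n /\
    forall S : {set 'I_n}, n <= E * #|S| ->
      exists fs1 f fs2, fs = fs1 ++ f :: fs2 /\ hit pat hi (code (@nat_of_ord _) fs2) f S.
Proof.
move=> E0 k0 q1.
pose L := 4 * E * k.
have L0 : 0 < L by rewrite !muln_gt0 E0 k0.
(* The number of levels does not depend on [n]: since [2 ^ n] is the [g]-th power of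
   [2 ^ (2 * E * L)], raising [hm] to the power [g] leaves less than one surviving set. *)
have [m m0 hm] := @large_power_ratio (q ^ L) (2 * E * L)
  (leq_trans q1 (leq_pexp2l (ltnW q1) L0)).
pose g := (n0 + q ^ m).+1; pose n := 2 * E * L * g.
have [fs sfs hfs] : exists2 fs : seq ('I_n -> 'I_q), size fs = m &
    #|[set S : {set 'I_n} | (n <= E * #|S|) && unhit pat hi fs S]| * (q ^ L) ^ (g * m)
      <= 2 ^ n * (q ^ L).-1 ^ (g * m).
  apply: levels => //.
  rewrite -/L /n -mulnA mulnCA leq_mul2l /g; nia.
exists n, fs; split; first by rewrite /n /g; nia.
move=> S bigS; apply: unhitPn; apply/negP => uS.
move: hfs; rewrite leqNgt => /negP; apply.
apply: leq_trans (_ : (q ^ L) ^ (g * m) <= _).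
  rewrite /n [in 2 ^ _]expnM mulnC [g * m]mulnC !(expnM _ m) mulnC -expnMn ltn_exp2r //.
rewrite -{1}[(q ^ L) ^ _]mul1n leq_mul2r; apply/orP; right.
by apply/card_gt0P; exists S; rewrite inE bigS.
Qed.

End Combinatorics.

(** * Matrices close to the identity, and a rank bound *)

(** If [m] is the largest [|c i 0|], the off-diagonal part contributes at most [m / 4]; hence
    [m <= b + m / 4], so [m / 4 <= b / 3]. *)
Lemma near_id_bound (F : realFieldType) (d : nat) (M : 'M[F]_d) (e b : F) (c : 'cV[F]_d) :
  0 <= e -> d%:R * e <= 4^-1 ->
  (forall i, M i i = 1) -> (forall i j, i != j -> `|M i j| <= e) ->
  (forall i, `|(M *m c) i 0| <= b) -> 0 <= b ->
  forall i, `|c i 0 - (M *m c) i 0| <= 3^-1 * b.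
Proof.
move=> e0 de Mii Mij Mc b0.
pose m := \big[Num.max/0]_i `|c i 0|.
have cm i : `|c i 0| <= m by apply: le_bigmax.
have m0 : 0 <= m by apply: bigmax_ge_id.
have diff i : `|c i 0 - (M *m c) i 0| <= 4^-1 * m.
  rewrite mxE (bigD1 i) //= Mii mul1r opprD addrA subrr add0r normrN.
  apply: le_trans (ler_norm_sum _ _ _) _.
  apply: (@le_trans _ _ (\sum_(j < d) e * m)).
    rewrite [leRHS](bigD1 i) //= -[leLHS]add0r lerD ?mulr_ge0 //.
    by apply: ler_sum => j ji; rewrite normrM; apply: ler_pM => //; apply: Mij; rewrite eq_sym.
  by rewrite sumr_const card_ord -[_ *+ d]mulr_natl mulrA ler_wpM2r.
have mb : m <= b + 4^-1 * m.
  apply: bigmax_le => [|i _]; first by move: m0 b0; lra.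
  rewrite -[c i 0](subrK ((M *m c) i 0)) addrC.
  by apply: le_trans (ler_normD _ _) _; rewrite lerD.
move=> i; apply: le_trans (diff i) _; lra.
Qed.

Lemma near_id_unitmx (F : realFieldType) (d : nat) (M : 'M[F]_d) (e : F) :
  0 <= e -> d%:R * e <= 4^-1 ->
  (forall i, M i i = 1) -> (forall i j, i != j -> `|M i j| <= e) -> M \in unitmx.
Proof.
move=> e0 de Mii Mij; rewrite -unitmx_tr -row_free_unit; apply: inj_row_free => v vM.
have Mv : M *m v^T = 0 by rewrite -[LHS]trmxK trmx_mul trmxK vM trmx0.
apply/rowP => i; rewrite mxE.
have := near_id_bound e0 de Mii Mij (c := v^T) (b := 0).
rewrite Mv => /(_ _ (lexx _) i).
rewrite !mxE subr0 mulr0 normr_le0 => h; apply/eqP; apply: h => j.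
by rewrite mxE normr0.
Qed.

Lemma aff_rank_le_card (d n : nat) (y : 'I_n -> 'rV[R]_d) (S : {set 'I_n}) :
  (aff_rank y S <= #|S|)%N.
Proof.
have sub : (hom_mx y S <= rowsub (fun k : 'I_#|S| => enum_val k) (hom_mx y S))%MS.
  apply/row_subP => i; have [iS|iS] := boolP (i \in S).
    by rewrite -{1}(enum_rankK_in iS iS) -row_rowsub row_sub.
  suff -> : row i (hom_mx y S) = 0 by exact: sub0mx.
  by apply/rowP => j; rewrite !mxE (negbTE iS) mxE.
exact: leq_trans (mxrankS sub) (rank_leq_row _).
Qed.

(** * Facets of points with widely separated coordinates *)

Section Tropical.
(* [x i j] plays the role of the logarithm of the coordinate [y i 0 j] to a large base. *)
Variables (d n : nat) (y : 'I_n -> 'rV[R]_d) (x : 'I_n -> 'I_d -> nat) (K : R).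
Hypothesis d0 : (0 < d)%N.
Hypothesis Kd : 4 * d%:R <= K.
Hypothesis y0 : forall i j, 0 < y i 0 j.
Hypothesis yK : forall i i' j, (x i j < x i' j)%N -> K * y i 0 j <= y i' 0 j.

Let d1 : (1 : R) <= d%:R. Proof. by rewrite ler1n. Qed.
Let K4 : 4 <= K. Proof. by move: d1 Kd; lra. Qed.

Lemma tropical_convex_position :
  (forall i q, q != i -> exists j, (x i j < x q j)%N) -> convex_position y.
Proof.
move=> sep i [w [w0 wi w1 yi]].
(* This linear functional is [d] at [y i] and at least [K] at every other point, so no convex
   combination of the others reaches [y i]. *)
pose g q : R := \sum_(j < d) y q 0 j / y i 0 j.
have gi : g i = d%:R.
  rewrite /g (eq_bigr (fun=> 1)) ?sumr_const ?card_ord // => j _.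
  by rewrite divff // gt_eqF.
have gq q : q != i -> K <= g q.
  move=> /sep[j xj]; rewrite /g (bigD1 j) //= ler_wpDr //.
    by apply: sumr_ge0 => k _; rewrite divr_ge0 // ltW.
  by rewrite ler_pdivlMr // yK.
have : g i = \sum_q w q * g q.
  rewrite /g; under [RHS]eq_bigr => q _ do rewrite mulr_sumr.
  rewrite exchange_big /=; apply: eq_bigr => j _.
  by rewrite {1}yi summxE mulr_suml; apply: eq_bigr => q _; rewrite !mxE mulrA.
have : \sum_q w q * K <= \sum_q w q * g q.
  apply: ler_sum => q _; have [->|qi] := eqVneq q i.
    by rewrite wi ?mul0r // !inE eqxx.
  by rewrite ler_wpM2l // gq.
rewrite -mulr_suml w1 mul1r gi => h1 h2.
by move: h1; rewrite -h2; move: d1 Kd; lra.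
Qed.

(** After scaling coordinate [j] by its value at [p j], the chosen points form a nearly identity
    matrix, so the hyperplane through them has coefficients of at least 1/2. At any other point one
    term alone is at least [K / 2 > 1]. *)
Lemma tropical_facet (p : 'I_d -> 'I_n) :
  (forall i j, i != j -> (x (p i) j < x (p j) j)%N) ->
  (forall q, (exists i, q = p i) \/ exists j, (x (p j) j < x q j)%N) ->
  is_facet y [set p i | i in 'I_d].
Proof.
move=> xp xq.
have K0 : 0 < K by move: K4; lra.
pose M : 'M[R]_d := \matrix_(i, j) (y (p i) 0 j / y (p j) 0 j).
have Mii i : M i i = 1 by rewrite mxE divff // gt_eqF.
have Mij i j : i != j -> `|M i j| <= K^-1.
  move=> ij; rewrite mxE ger0_norm; last by rewrite divr_ge0 // ltW.
  by rewrite ler_pdivrMr // ler_pdivlMl // yK // xp.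
have e0 : 0 <= K^-1 by rewrite invr_ge0 ltW.
have de : d%:R * K^-1 <= 4^-1.
  by rewrite ler_pdivrMr // ler_pdivlMl.
have Mu := near_id_unitmx e0 de Mii Mij.
pose c : 'cV[R]_d := invmx M *m const_mx 1.
have Mc : M *m c = const_mx 1 by rewrite mulmxA mulmxV // mul1mx.
have c_half i : 2^-1 <= c i 0.
  have := near_id_bound e0 de Mii Mij (c := c) (b := 1).
  rewrite Mc => h.
  have {h} : `|c i 0 - 1| <= 3^-1 * 1.
    have := h _ ler01 i; rewrite [const_mx 1 i 0]mxE; apply => j.
    by rewrite mxE normr1.
  by rewrite ler_norml => /andP[+ _]; lra.
have c0 i : 0 < c i 0 by apply: lt_le_trans (c_half i); rewrite invr_gt0.
(* The sign is reversed because [is_facet] asks for a maximum, while the chosen points minimize the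
   positive functional. *)
pose a : 'rV[R]_d := \row_j (- (c j 0 / y (p j) 0 j)).
have dot_p i : dot a (y (p i)) = -1.
  have := congr1 (fun A : 'cV[R]_d => A i 0) Mc; rewrite [in RHS]mxE mxE => <-.
  rewrite /dot -sumrN; apply: eq_bigr => j _; rewrite !mxE; ring.
have dot_q q : (forall i, q <> p i) -> dot a (y q) < -1.
  move=> qp; have [[i /qp//]|[j xj]] := xq q.
  rewrite /dot (bigD1 j) //= ltr_wnDr //.
    apply: sumr_le0 => k _; rewrite mxE mulNr oppr_le0 mulr_ge0 ?divr_ge0 ?ltW //.
  rewrite mxE mulNr ltrN2 mulrAC -mulrA.
  apply: (@lt_le_trans _ _ (2^-1 * K)); first by move: K4; lra.
  apply: ler_pM => //; first by lra.
    exact: ltW.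
  by rewrite ler_pdivlMr // yK.
have p_inj : injective p.
  move=> i j e; apply/eqP; apply/negPn/negP => /xp; by rewrite e ltnn.
exists a, (-1); split.
- apply/eqP => /rowP/(_ (Ordinal d0)); rewrite [a _ _]mxE [RHS]mxE => /eqP.
  by rewrite oppr_eq0 gt_eqF // divr_gt0.
- move=> q; case: (pselect (exists i, q = p i)) => [[i ->]|nq]; first by rewrite dot_p.
  by rewrite ltW // dot_q // => i e; apply: nq; exists i.
- apply/setP => q; rewrite inE; apply/imsetP/eqP => [[i _ ->]|e]; first exact: dot_p.
  case: (pselect (exists i, q = p i)) => [[i ->]|nq]; first by exists i.
  have : dot a (y q) < -1 by apply: dot_q => i ei; apply: nq; exists i.
  by rewrite e ltxx.
set F := [set _ | _ in _].
have cF : #|F| = d by rewrite card_imset // card_ord.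
apply/eqP; rewrite eqn_leq; apply/andP; split.
  by rewrite -[leqRHS]cF aff_rank_le_card.
(* The invertible [M] factors through the homogenized rows of [F], whose rank is therefore at least
   [d]. *)
pose D := diag_mx (\row_j (y (p j) 0 j)^-1).
have MQ : M = rowsub p (hom_mx y F) *m col_mx D 0.
  have -> : rowsub p (hom_mx y F) = row_mx (\matrix_i y (p i)) (const_mx 1).
    apply/matrixP => i j; rewrite !mxE imset_f //.
    by rewrite !mxE; case: (split _) => k; rewrite !mxE // (ord1 k) eqxx.
  rewrite mul_row_col mulmx0 addr0.
  by apply/matrixP => i j; rewrite mul_mx_diag !mxE.
rewrite -[leqLHS](mxrank_unit Mu) {1}MQ.
apply: leq_trans (mxrankM_maxl _ _) (mxrankS (rowsub_sub _ _)).
Qed.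

End Tropical.

(** * General position and simpliciality *)

Section GenericRank.
Variables (d n : nat) (y : 'I_n -> 'rV[R]_d).
Hypothesis generic : forall g : 'I_(d + 1) -> 'I_n, injective g ->
  rowsub g (hom_mx y setT) \in unitmx.

Lemma generic_aff_rank (S : {set 'I_n}) : (d < #|S|)%N -> aff_rank y S = d.+1.
Proof.
rewrite -addn1 => dS; pose g k := enum_val (widen_ord dS k).
have g_inj : injective g by move=> a b /enum_val_inj e; apply: val_inj; case: e.
have := generic g_inj; have -> : rowsub g (hom_mx y setT) = rowsub g (hom_mx y S).
  by apply/matrixP => i j; rewrite !mxE inE enum_valP.
move=> /mxrank_unit rk; apply/eqP; rewrite eqn_leq rank_leq_col /=.
by rewrite -{1}rk mxrankS // rowsub_sub.
Qed.

Lemma generic_simplicial : simplicial y.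
Proof.
move=> F [a [b [_ _ _ rF]]]; rewrite /aff_indep eqn_leq aff_rank_le_card rF /=.
by rewrite leqNgt; apply/negP => /generic_aff_rank; rewrite rF => /n_Sn.
Qed.

Lemma generic_full_dim : (d < n)%N -> full_dim y.
Proof. by move=> dn; apply: generic_aff_rank; rewrite cardsT card_ord. Qed.

End GenericRank.

(** * The moment curve and the choice of a large base *)

(** A kernel vector lists the coefficients, constant term last, of a polynomial of degree at most
    [d] with [d + 1] roots. *)
Lemma moment_unitmx (F : fieldType) (d : nat) (z : 'I_(d + 1) -> F) : injective z ->
  \matrix_(k, c) (match split c with inl j => z k ^+ (j : 'I_d).+1 | inr _ => 1 end)
    \in unitmx.
Proof.
move=> z_inj; set A := (X in X \in _).
rewrite -unitmx_tr -row_free_unit; apply: inj_row_free => v vA.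
pose w e := if e is e'.+1 then if insub e' is Some j then v 0 (lshift 1 j) else 0
            else v 0 (rshift d 0).
have P0 : \poly_(e < d.+1) w e = 0.
  apply: (@roots_geq_poly_eq0 _ _ [seq z k | k <- enum 'I_(d + 1)]).
  - apply/allP => _ /mapP[k _ ->]; rewrite rootE horner_poly.
    have := congr1 (fun B : 'rV[F]_(d + 1) => B 0 k) vA.
    rewrite mxE [RHS]mxE big_split_ord big_ord1 /= => e; apply/eqP; rewrite -[RHS]e.
    rewrite big_ord_recl addrC !mxE (unsplitK (inr _)) mulr1; congr (_ + _).
    by apply: eq_bigr => j _; rewrite !mxE (unsplitK (inl _)) /= valK.
  - by rewrite map_inj_uniq ?enum_uniq.
  - by rewrite size_map size_enum_ord addn1 size_poly.
have w0 e : (e < d.+1)%N -> w e = 0.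
  by move=> ed; have := coef_poly d.+1 w e; rewrite ed P0 coef0.
apply/rowP => c; rewrite mxE -(splitK c); case: (split c) => j /=.
  by have := w0 j.+1; rewrite /= valK; apply; rewrite ltnS.
by rewrite (ord1 j) -[LHS]/(w 0%N) w0.
Qed.

Lemma poly_nonroot_ge (F : realFieldType) (P : {poly F}) (U : F) :
  P != 0 -> exists2 u, U <= u & P.[u] != 0.
Proof.
move=> P0; apply: contrapT => nP; move/eqP: P0; apply.
apply: (@roots_geq_poly_eq0 _ _ [seq U + t%:R | t <- iota 0 (size P)]).
- apply/allP => _ /mapP[t _ ->]; rewrite rootE; apply/negPn/negP => h; apply: nP.
  by exists (U + t%:R) => //; rewrite lerDl.
- rewrite map_inj_uniq ?iota_uniq // => a b /addrI/eqP.
  by rewrite eqr_nat => /eqP.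
- by rewrite size_map size_iota.
Qed.

Lemma exists_tropical_points (d n : nat) (x : 'I_n -> 'I_d -> nat) (K : R) : 0 <= K ->
  exists y : 'I_n -> 'rV[R]_d,
    [/\ forall i j, 0 < y i 0 j,
        forall i i' j, (x i j < x i' j)%N -> K * y i 0 j <= y i' 0 j
      & forall g : 'I_(d + 1) -> 'I_n, injective g -> rowsub g (hom_mx y setT) \in unitmx].
Proof.
move=> K0.
(* In the unknown u, the homogenized points: at u = 0 they lie on the moment curve. *)
pose PM (g : 'I_(d + 1) -> 'I_n) : 'M[{poly R}]_(d + 1) := \matrix_(k, c)
  match split (c : 'I_(d + 1)) with
  | inl j => 'X^((x (g k) j).+1) + ((g k)%:R ^+ j.+1)%:P
  | inr _ => 1
  end.
have PM0 g : injective g -> \det (PM g) != 0.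
  move=> g_inj; apply/eqP => e.
  have : \det (map_mx (horner_eval 0) (PM g)) = 0.
    by rewrite det_map_mx e rmorph0.
  apply/eqP; rewrite -unitfE -unitmxE.
  have z_inj : injective (fun k => (g k)%:R : R).
    by move=> a b /eqP; rewrite eqr_nat => /eqP/val_inj/g_inj.
  apply: (eq_ind _ (fun A => A \in unitmx) (moment_unitmx z_inj)).
  apply/matrixP => k c; rewrite !mxE; case: (split c) => j.
    by rewrite /horner_eval !hornerE /= expr0n add0r.
  by rewrite /horner_eval !hornerE.
(* One value of [u] must avoid the roots of all these determinants at once. *)
pose P := \prod_(g : {ffun 'I_(d + 1) -> 'I_n} | injectiveb g) \det (PM g).
have P0 : P != 0 by apply/prodf_neq0 => g /injectiveP/PM0.
(* With [n ^ d <= u] the moment term at most doubles [u ^+ (x i j).+1]; [2 * K <= u] then absorbs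
   this factor 2 together with [K]. *)
have [u Uu Pu] := poly_nonroot_ge (1 + n%:R ^+ d + 2 * K) P0.
have nd0 : 0 <= (n%:R : R) ^+ d by rewrite exprn_ge0.
have u1 : 1 <= u by move: Uu; lra.
have u0 : 0 < u by lra.
have und : n%:R ^+ d <= u by move: Uu; lra.
have uK : 2 * K <= u by move: Uu; lra.
pose y (i : 'I_n) : 'rV[R]_d := \row_j (u ^+ (x i j).+1 + i%:R ^+ j.+1).
have small (i : 'I_n) (j : 'I_d) : (i%:R : R) ^+ j.+1 <= u ^+ (x i j).+1.
  apply: (@le_trans _ _ u); last by rewrite -{1}[u]expr1 ler_weXn2l.
  apply: le_trans und; rewrite -!natrX ler_nat.
  apply: leq_trans (_ : n ^ j.+1 <= _)%N; first by rewrite leq_exp2r // ltnW.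
  by rewrite leq_pexp2l // (leq_ltn_trans _ (ltn_ord i)).
exists y; split.
- by move=> i j; rewrite mxE ltr_wpDr ?exprn_ge0 // exprn_gt0.
- move=> i i' j xj; rewrite !mxE.
  apply: (@le_trans _ _ (u ^+ (x i' j).+1)); last by rewrite lerDl exprn_ge0.
  apply: (@le_trans _ _ (u ^+ (x i j).+2)); last by rewrite ler_weXn2l.
  rewrite [leRHS]exprS; set s := u ^+ _.
  apply: (@le_trans _ _ (K * (s + s))); first by rewrite ler_wpM2l // lerD2l small.
  by rewrite -mulr2n -mulr_natl mulrCA mulrA ler_wpM2r // exprn_ge0 // ltW.
- move=> g g_inj.
  have -> : rowsub g (hom_mx y setT) = map_mx (horner_eval u) (PM g).
    apply/matrixP => k c; rewrite !mxE inE mxE; case: (split c) => j.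
      by rewrite mxE /horner_eval !hornerE.
    by rewrite mxE (ord1 j) eqxx /horner_eval !hornerE.
  rewrite unitmxE det_map_mx unitfE /horner_eval.
  move: Pu; rewrite /P horner_prod => /prodf_neq0/(_ (finfun g)).
  have -> : PM (finfun g) = PM g.
    by apply/matrixP => k c; rewrite !mxE ffunE.
  by apply; apply/injectiveP => a b; rewrite !ffunE => /g_inj.
Qed.

(** * The [d] orders and the facets coming from hits *)

Section Orders.
Local Open Scope nat_scope.

(* The letters are ordered so that, among [letter t], the largest is [letter 1] and the
   smallest [letter 2]; the remaining letter [ord_max] lies above all of them. *)
Definition letter (d : nat) (t : 'I_d) : 'I_d.+3 :=
  inord (if t == 1 :> nat then d.+1 else if t == 2 :> nat then 0 else t.+1).

(** Order [j] is made to be largest at the [j]-th point of a hit. The subtractions reverse an order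
    and never truncate; the last case reads a 0/1 word in base [d.+3]. *)
Definition order (d n : nat) (fs : seq ('I_n -> 'I_d.+3)) (i : 'I_n) (j : 'I_d) : nat :=
  if j == 0 :> nat then n - i
  else if j == 1 :> nat then code (@nat_of_ord _) fs i
  else if j == 2 :> nat then d.+3 ^ size fs - code (@nat_of_ord _) fs i
  else if j == d.-1 :> nat then nat_of_ord i
  else code (fun a => a == letter j) fs i.

Lemma letterE d (t : 'I_d) : letter t =
  (if t == 1 :> nat then d.+1 else if t == 2 :> nat then 0 else t.+1) :> nat.
Proof.
rewrite inordK //; case: ifP => [_|_]; first by lia.
by case: ifP => // _; have := ltn_ord t; lia.
Qed.

Lemma order_sep d n (fs : seq ('I_n -> 'I_d.+3)) (i q : 'I_n) : 3 < d -> q != i ->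
  exists j, order fs i j < order fs q j.
Proof.
move=> d3 qi; have := ltn_ord i; have := ltn_ord q => qn ni.
have [h|h|/val_inj h] := ltngtP (q : nat) (i : nat); last by rewrite h eqxx in qi.
  have j0 : 0 < d by lia.
  by exists (Ordinal j0); rewrite /order /=; lia.
have jd : d.-1 < d by lia.
exists (Ordinal jd); rewrite /order /= eqxx; do 3!(case: eqP => [?|_]; first by lia).
by [].
Qed.

Lemma hit_tropical d n (fs1 fs2 : seq ('I_n -> 'I_d.+3)) f (S : {set 'I_n}) : 3 < d ->
  let fs := fs1 ++ f :: fs2 in
  hit (@letter d) ord_max (code (@nat_of_ord _) fs2) f S ->
  exists p : 'I_d -> 'I_n,
    [/\ forall i, p i \in S,
        forall i j, i != j -> order fs (p i) j < order fs (p j) j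
      & forall q, (exists i, q = p i) \/ exists j, order fs (p j) j < order fs q j].
Proof.
move=> d3 fs [p [pS p_lt p_lab p_pat p_int]]; exists p.
have val_q (a : 'I_d.+3) : a < d.+3 := ltn_ord a.
have ind_q (j : 'I_d) (a : 'I_d.+3) : (a == letter j) < d.+3 by case: (_ == _).
have code_max i : code (@nat_of_ord _) fs i < d.+3 ^ size fs by apply: code_lt.
have [l0 l1 l2 ld] : [/\ 0 < d, 1 < d, 2 < d & d.-1 < d] by split; lia.
pose o0 := Ordinal l0; pose o1 := Ordinal l1; pose o2 := Ordinal l2; pose od := Ordinal ld.
have ordd i : order fs i od = i.
  by rewrite /order /= eqxx; do 3!(case: eqP => [?|_]; first by lia).
have p_le0 i : p o0 <= p i.
  have [e|i0] := posnP i; last by apply/ltnW/(@p_lt o0).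
  by rewrite (_ : i = o0) //; apply: val_inj.
have p_led i : p i <= p od.
  have [e|h] := eqVneq (i : nat) d.-1; first by rewrite (_ : i = od) //; apply: val_inj.
  by apply/ltnW/(@p_lt i od) => /=; have := ltn_ord i; lia.
have code_step i j : code (@nat_of_ord _) fs2 i = code (@nat_of_ord _) fs2 j -> f i < f j ->
    code (@nat_of_ord _) fs i < code (@nat_of_ord _) fs j.
  by move=> e fij; apply: code_mono => //=; rewrite e ltn_add2l.
split=> //.
  move=> i j ij; have ijv : (i != j :> nat) by [].
  rewrite /order; case: ifP => [/eqP j0|j0].
    have := @p_lt j i; have := ltn_ord (p i); lia.
  case: ifP => [/eqP j1|j1].
    apply: code_step; first exact: p_lab.
    rewrite !p_pat !letterE j1 eqxx; have := ltn_ord i.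
    case: eqP => [|_]; first lia.
    case: eqP => [_|_]; lia.
  case: ifP => [/eqP j2|j2].
    have := code_max (p i); suff : code (@nat_of_ord _) fs (p j) < code (@nat_of_ord _) fs (p i) by lia.
    apply: code_step; first exact: p_lab.
    rewrite !p_pat !letterE j2 /=.
    case: eqP => [|_] //; case: eqP => [|_] //; lia.
  case: ifP => [/eqP jd|jd]; first by apply: p_lt; have := ltn_ord i; lia.
  (* Older letters agree on the hit, and the new letter has indicator 1 at [p j] only. *)
  apply: code_mono => //=; rewrite (code_inj _ (p_lab i j)) ltn_add2l !p_pat eqxx.
  case: eqP => // /(congr1 val) /=; rewrite !letterE j1 j2.
  case: eqP => [|_]; first by have := ltn_ord j; lia.
  by case: eqP => [|_]; lia.
(* Points outside the interval of the hit win in a line order. Inside it, a point of the same class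
   is some [p t] or carries the top letter and wins in order 1; a point of another class wins in one
   of the two lexicographic orders. *)
move=> q; have [q0|q0] := ltnP q (p o0).
  by right; exists o0; rewrite /order /=; have := ltn_ord (p o0); lia.
have [qd|qd] := ltnP (p od) q.
  by right; exists od; rewrite !ordd.
have [e|e] := eqVneq (code (@nat_of_ord _) fs2 q) (code (@nat_of_ord _) fs2 (p o0)).
  have [|h|h] := p_int q o0 od _ e; first by rewrite q0 qd.
    by left.
  right; exists o1; rewrite /order /=; apply: code_step; first by rewrite e; apply: p_lab.
  by rewrite h p_pat letterE /=.
have cat_cons : fs = (fs1 ++ [:: f]) ++ fs2 by rewrite -catA.
right; move: e; rewrite neq_ltn => /orP[h|h].
  exists o2; rewrite /order /=; have /= := code_max (p o2).
  suff /= : code (@nat_of_ord _) fs q < code (@nat_of_ord _) fs (p o2) by lia.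
  by rewrite cat_cons; apply: code_mono => //; rewrite (p_lab o2 o0).
exists o1; rewrite /order /= cat_cons; apply: code_mono => //.
by rewrite (p_lab o1 o0).
Qed.

End Orders.

(** * From hits to the transversal ratio *)

Lemma le_rho (d n : nat) (p : 'I_n -> 'rV[R]_d) (r : R) : (0 < n)%N -> r <= 1 ->
  (forall T, Defs.transversal p T -> r * n%:R <= #|T|%:R) -> r <= rho p.
Proof.
move=> n0 r1 hT; have n0' : 0 < n%:R :> R by rewrite ltr0n.
rewrite /rho ler_pdivlMr // /tau.
(* The default value [n] of the minimum corresponds to ratio 1, which is where [r <= 1] enters. *)
elim/big_ind: _ => [|a b ha hb|T /asboolP]; last exact: hT.
  by rewrite -[leRHS]mul1r ler_wpM2r // ltW.
by rewrite /minn; case: ifP.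
Qed.

Theorem theorem1p1 :
  forall (d : nat) (r : R), (5 <= d)%N -> 0 <= r -> r < 1 ->
  exists (n : nat) (p : 'I_n -> 'rV[R]_d),
    [/\ convex_position p, full_dim p, simplicial p & r <= rho p].
Proof.
move=> d r d5 _ r1.
have d3 : (3 < d)%N by apply: leq_trans d5.
have d0 : (0 < d)%N by apply: leq_trans d5.
(* Since [1 / E < 1 - r], the complement of a set of fewer than [r * n] points is dense enough to
   contain a hit, whose facet that set misses. *)
pose E := Num.bound (1 - r)^-1.
have r1' : 0 < 1 - r by rewrite subr_gt0.
have hE : (1 - r)^-1 < E%:R by apply: archi_boundP; rewrite invr_ge0 ltW.
have E0 : (0 < E)%N.
  by rewrite -(ltr0n R); apply: lt_trans hE; rewrite invr_gt0.
have [n [fs [dn hfs]]] := dense_hitting d.+1 (@letter d) ord_max E0 d0 (isT : 1 < d.+3)%N.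
have [y [y0 yK gen]] :=
  @exists_tropical_points d n (order fs) (4 * d%:R) (mulr_ge0 (ler0n _ _) (ler0n _ _)).
exists n, y; split.
- apply: (tropical_convex_position d0 (lexx _) y0 yK) => i q qi.
  exact: order_sep.
- exact: generic_full_dim gen dn.
- exact: generic_simplicial gen.
apply: le_rho; [exact: leq_trans dn | exact: ltW |] => T trT.
rewrite leNgt; apply/negP => hT.
have [|fs1 [f [fs2 [efs hitf]]]] := hfs (~: T).
  rewrite -(ler_nat R) natrM.
  have cT : #|T|%:R + #|~: T|%:R = n%:R :> R by rewrite -natrD cardsC card_ord.
  have h : (1 - r) * n%:R <= #|~: T|%:R by move: hT cT; lra.
  apply: (@le_trans _ _ (E%:R * ((1 - r) * n%:R))); last by rewrite ler_wpM2l.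
  rewrite mulrA -[leLHS]mul1r ler_wpM2r //.
  by rewrite -ler_pdivrMr // mul1r ltW.
have [p [pT p1 p2]] := hit_tropical fs1 d3 hitf; rewrite -efs in p1 p2.
have [i iT] := trT _ (tropical_facet d0 (lexx _) y0 yK p1 p2).
case/imsetP => j _ ij; have := pT j.
by rewrite inE -ij iT.
Qed.
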